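(* Let $G$ be a group with a finite generating set $X$, and suppose that $G$ admits a bicombing of narrow shape with respect to $X$. Then $G$ is finitely presented and has an isoperimetric function of growth $n^{O(\log n)}$; that is, there are a finite presentation of $G$, an isoperimetric function $F:\mathbb{N}\to\mathbb{N}$ for $G$ with respect to this presentation, and a constant $C>0$ such that $F(n)\le n^{C\log n}$ for all sufficiently large $n$.
   Context: Let $G$ be a group with finite generating set $X$, $\Gamma_X(G)$ its Cayley graph with the word metric $d$ (vertices are identified with elements of $G$). Paths: a path $\sigma(g,h):[0,\infty)\to\Gamma_X(G)$ from $g$ to $h$ is required to be at vertices at integer times: it starts at $g$ at time $0$, from time $t=n$ to $t=n+1$ it either travels along one edge to an adjacent vertex or pauses at a vertex, and it is eventually constant equal to $h$. Its length is $|\sigma(g,h)|=\min\{t : \sigma(g,h)|_{[t,\infty)} \text{ is constant } =h\}$ (pauses before reaching the end for good are counted). Write $\sigma(h)=\sigma(1,h)$. Bicombing of narrow shape: a choice of such a path $\sigma(g,h)$ for every $(g,h)\in G\times G$ such that (1) (recursive) there is an increasing polynomial $f:\mathbb{N}\to\mathbb{N}$ with $|\sigma(g)|\le f(d(1,g))$ for all $g\in G$; (2) there are an integer $M>1$ and a real number $k>2$ such that $|\sigma(g,g)|\le Mk/2$ for all $g\in G$, and for all $g,h\in G$, all $a,b\in X^{\pm1}\cup\{1\}$ and all integers $t\ge 0$, $$|\sigma(\sigma(g,h)(t),\,\sigma(ga,hb)(t))|\le \max\big((|\sigma(g,h)|+|\sigma(ga,hb)|)/k,\; M/2\big).$$ Isoperimetric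 function: given a finite presentation of $G$, a function $F:\mathbb{N}\to\mathbb{N}$ is an isoperimetric function if for every word $w$ in the generators of length $n$ with $w=1$ in $G$, the minimum number of 2-cells in a van Kampen diagram for $w$ over the presentation is at most $F(n)$. *)

(* Defs.v *)
From HB Require Import structures.
From mathcomp Require Import all_boot all_order all_algebra all_fingroup.
From mathcomp Require Import finmap.
From mathcomp Require Import all_classical all_reals all_analysis.

Set Implicit Arguments.
Unset Strict Implicit.
Unset Printing Implicit Defensive.

Import Order.TTheory GRing.Theory Num.Theory.

Local Open Scope classical_set_scope.
Local Open Scope group_scope.
Local Open Scope nat_scope.

Definition is_least (P : set nat) (n : nat) : Prop :=
  P n /\ forall m, P m -> n <= m.

(* The junk value 0 is only taken when P is empty. *)
Definition least (P : set nat) : nat := xget 0 [set n | is_least P n].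

Section CayleyGraph.
Variables (G : groupType) (X : {fset G}).

Definition generates : Prop :=
  forall S : {pred G}, {subset X <= S} -> group_closed S -> forall g, g \in S.

Definition Xpm : pred G := fun x => (x \in X) || (x^-1%g \in X).

(* Edges join g to g x for x in X^{+-1}; a loop, which could only come from
   1 in X, does not lead to an adjacent vertex. *)
Definition cayley_adj : rel G := fun g h => (g != h) && Xpm (g^-1 * h)%g.

Definition word_metric (g h : G) : nat :=
  least [set n | exists s : seq G,
    [/\ path cayley_adj g s, last g s = h & size s = n]].

(* A path is at vertices at integer times and traverses one edge or pauses in
   between, so it is recorded by its positions at integer times. *)
Definition is_path (p : nat -> G) (g h : G) : Prop :=
  [/\ p 0 = g,
      forall t, p t.+1 = p t \/ cayley_adj (p t) (p t.+1)
    & exists T, forall t, T <= t -> p t = h].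

End CayleyGraph.

Definition path_length (G : groupType) (p : nat -> G) (h : G) : nat :=
  least [set t | forall s, t <= s -> p s = h].

Section NarrowShape.
Variables (R : realType) (G : groupType) (X : {fset G}).
Variable sigma : G -> G -> nat -> G.

Let len (g h : G) : nat := path_length (sigma g h) h.

Definition bicombing : Prop := forall g h, is_path X (sigma g h) g h.

Definition recursive_bicombing : Prop :=
  exists f : nat -> nat,
    [/\ {homo f : m n / m < n},
        exists q : {poly R}, forall n, ((f n)%:R = q.[n%:R])%R
      & forall g, len 1%g g <= f (word_metric X 1%g g)].

Definition narrow_bicombing : Prop :=
  exists (M : nat) (k : R),
    [/\ 1 < M, (2 < k)%R,
        forall g, ((len g g)%:R <= M%:R * k / 2 :> R)%R
      & forall (g h a b : G) (t : nat),
          (a == 1%g) || Xpm X a -> (b == 1%g) || Xpm X b ->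
          let g' := (g * a)%g in let h' := (h * b)%g in
          ((len (sigma g h t) (sigma g' h' t))%:R
             <= Num.max (((len g h)%:R + (len g' h')%:R) / k) (M%:R / 2)
             :> R)%R].

Definition narrow_shape : Prop :=
  [/\ bicombing, recursive_bicombing & narrow_bicombing].

End NarrowShape.

(* The letter (a, false) stands for a, and (a, true) for its formal inverse. *)
Definition letter (A : finType) : Type := (A * bool)%type.
Definition word (A : finType) : Type := seq (A * bool).

Section Words.
Variable A : finType.

Definition letter_inv (l : letter A) : letter A := (l.1, ~~ l.2).
Definition word_inv (w : word A) : word A := rev (map letter_inv w).

Definition eval_letter (G : groupType) (phi : A -> G) (l : letter A) : G :=
  if l.2 then (phi l.1)^-1%g else phi l.1.
Definition eval (G : groupType) (phi : A -> G) (w : word A) : G :=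
  foldr (fun l g => eval_letter phi l * g)%g 1%g w.

(* The words representing an element of the normal closure of rels in the
   free group on A. *)
Inductive normal_closure (rels : seq (word A)) : word A -> Prop :=
| NCrel r : r \in rels -> normal_closure rels r
| NC1 : normal_closure rels [::]
| NCmul u v : normal_closure rels u -> normal_closure rels v ->
    normal_closure rels (u ++ v)
| NCinv u : normal_closure rels u -> normal_closure rels (word_inv u)
| NCconj c u : normal_closure rels u ->
    normal_closure rels (c ++ u ++ word_inv c)
| NCinsert u l v : normal_closure rels (u ++ v) ->
    normal_closure rels (u ++ [:: l; letter_inv l] ++ v)
| NCcancel u l v : normal_closure rels (u ++ [:: l; letter_inv l] ++ v) ->
    normal_closure rels (u ++ v).

Definition presents (G : groupType) (phi : A -> G) (rels : seq (word A)) :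
    Prop :=
  (forall g : G, exists w, eval phi w = g) /\
  (forall w, eval phi w = 1%g <-> normal_closure rels w).

(* A van Kampen diagram with at least one edge is a finite connected planar
   map drawn on the sphere, with one face distinguished as the outer one; its
   2-cells are the other faces.  The darts are the oriented edges, dopp reverses
   a dart and dnext d is the dart following d along the face lying on a fixed
   side of d.  Hence faces are the cycles of dnext, and vertices those of
   dopp * dnext (dopp first), which preserves the origin of a dart.  Planarity
   is Euler's formula.  dbase is the first dart of the boundary cycle of the
   outer face. *)
Record disc_diagram := DiscDiagram {
  dart :> finType;
  dopp : {perm dart};
  dnext : {perm dart};
  dlabel : dart -> A * bool;
  dbase : dart;
  _ : forall d, dopp (dopp d) = d;
  _ : forall d, dopp d != d;
  _ : forall d, dlabel (dopp d) = letter_inv (dlabel d);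
  _ : forall d, connect (fun x y => (y == dopp x) || (y == dnext x)) dbase d;
  _ : #|porbits (dopp * dnext)| + #|porbits dnext| = #|porbits dopp| + 2
}.

Definition face_word (D : disc_diagram) (d : D) : word A :=
  map (@dlabel D) (traject (dnext D) d #|porbit (dnext D) d|).

Definition outer_face (D : disc_diagram) : {set D} :=
  porbit (dnext D) (dbase D).

Inductive van_kampen_diagram := VKPoint | VKDisc of disc_diagram.

Definition boundary_word (K : van_kampen_diagram) : word A :=
  if K is VKDisc D then face_word (dbase D) else [::].

Definition num_cells (K : van_kampen_diagram) : nat :=
  if K is VKDisc D then #|porbits (dnext D) :\ outer_face D| else 0.

(* Every 2-cell reads, from a suitable start, a relator or its inverse. *)
Definition diagram_over (rels : seq (word A)) (K : van_kampen_diagram) : Prop :=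
  if K is VKDisc D then
    forall c, c \in porbits (dnext D) :\ outer_face D ->
      exists2 d : D, d \in c &
        (face_word d \in rels) || (word_inv (face_word d) \in rels)
  else True.

Definition is_area (rels : seq (word A)) (w : word A) (N : nat) : Prop :=
  is_least [set n | exists K, [/\ diagram_over rels K, boundary_word K = w
                                & num_cells K = n]] N.

Definition isoperimetric (G : groupType) (phi : A -> G) (rels : seq (word A))
    (F : nat -> nat) : Prop :=
  forall w : word A, eval phi w = 1%g ->
    exists2 N, is_area rels w N & N <= F (size w).

End Words.

(* Main.v *)
(* A word w = x_1...x_n with w = 1 is coned off to 1 by the combing paths of its
   prefixes g_i, which leaves n quadrilaterals with sides sigma(1,g_i), x_{i+1},
   sigma(1,g_{i+1}).  Let L bound the lengths of these combing paths.  Joining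
   the two combing paths of a quadrilateral at equal times by combing paths cuts
   it into at most L quadrilaterals of the same kind, whose combing paths are
   shorter by the factor 2/k < 1 as long as they exceed M/2.  After O(log L)
   rounds all pieces have perimeter at most 2M+2 and are relators.  Since L is
   polynomial in n, this uses n^{O(log n)} relators.

   No reduction of boundary words is ever needed: every word of length at most
   2M+4 that is trivial in G, including l l^-1, is taken as a relator. A diagram
   is then built outwards by drawing one edge at a time in the outer face, either
   a pendant one or one cutting off a new cell; these two moves obviously
   preserve planarity, and Euler's formula follows from counting how products
   with transpositions merge and split the cycles of a permutation. *)
Require Import Defs.
From mathcomp Require Import all_boot all_order all_algebra all_fingroup.
From mathcomp Require Import finmap.
From mathcomp Require Import all_classical all_reals all_analysis.
From mathcomp Require Import zify lra.

Set Implicit Arguments.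
Unset Strict Implicit.
Unset Printing Implicit Defensive.

Import Order.TTheory GRing.Theory Num.Theory.

Local Open Scope nat_scope.

(* MathComp-Analysis has its own [dopp] and [eval]. *)
Local Notation dopp := Defs.dopp.
Local Notation eval := Defs.eval.

(** * Cycles of permutations *)

Section Cycles.
Variable T : finType.
Implicit Types (s : {perm T}) (x y : T) (c : seq T).

(** A duplicate-free cycle of [s] is closed under [s], so it exhausts the orbit of [x]. This is what
    allows a face to be given by an explicit list of darts. *)
Lemma fcycle_porbit s x c : uniq (x :: c) -> fcycle s (x :: c) ->
  traject s x #|porbit s x| = x :: c.
Proof.
move=> Uc Cc; have Ec : x :: c = traject s x (size c).+1.
  move: Cc; rewrite /= rcons_path => /andP[/fpathP[n ->] _].
  by rewrite size_traject.
suff -> : #|porbit s x| = (size c).+1 by [].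
rewrite -[RHS]/(size (x :: c)) -(card_uniqP Uc); apply/eq_card => y.
rewrite porbit_traject; apply/trajectP/idP => [[i _ ->]|].
  elim: i => [|i IHi]; first exact: mem_head.
  by rewrite iterS; have /eqP -> := next_cycle Cc IHi; rewrite mem_next.
rewrite {1}Ec => /trajectP[i _ ->].
have : iter i s x \in porbit s x by rewrite -permX mem_porbit.
by rewrite porbit_traject => /trajectP.
Qed.

Lemma porbit_fcycle s x c : uniq (x :: c) -> fcycle s (x :: c) ->
  porbit s x =i x :: c.
Proof. by move=> Uc Cc y; rewrite porbit_traject (fcycle_porbit Uc Cc). Qed.

Lemma traject_porbit_fcycle s x : fcycle s (traject s x #|porbit s x|).
Proof.
have := card_porbit_neq0 s x; have := iter_porbit s x.
case: #|porbit s x| => // n itn _.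
by rewrite trajectS /= rcons_path fpath_traject /= last_traject -iterS itn eqxx.
Qed.

(** Together with [porbits_split], this is the count behind Euler's formula: a transposition joins
    the cycles of two points, or cuts the one cycle that contains both. *)
Lemma porbits_merge s x y : x \notin porbit s y ->
  (#|porbits (tperm x y * s)%g|).+1 = #|porbits s|.
Proof.
move=> xNy; have := porbits_mul_tperm s x y; rewrite /= xNy.
have -> : x != y by apply: contraNneq xNy => ->; exact: porbit_id.
by rewrite !addnS addn0 addn0 => -[].
Qed.

Lemma porbits_split s x y : x != y -> x \in porbit s y ->
  #|porbits (tperm x y * s)%g| = #|porbits s|.+1.
Proof.
move=> xDy xy; have := porbits_mul_tperm s x y.
by rewrite /= xy xDy /= addn0 addn1.
Qed.

Lemma notin_porbit_fix s x y : s y = y -> x != y -> x \notin porbit s y.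
Proof.
move=> sy; apply: contra => /porbitP[i ->]; apply/eqP.
by elim: i => [|i IHi]; rewrite ?expg0 ?perm1 // expgSr permM IHi.
Qed.

Lemma in_porbit_fun s x : s x \in porbit s x.
Proof. by have := mem_porbit s 1 x; rewrite expg1. Qed.

Lemma eq_porbit_in s x y z : x \in porbit s z -> y \in porbit s z ->
  x \in porbit s y.
Proof. by rewrite -!eq_porbit_mem => /eqP-> /eqP->. Qed.

End Cycles.

(** * Permutations with two added fixed points *)

Section AddTwoPoints.
Variable T : finType.
Implicit Types (s : {perm T}) (x y : T).

Definition plus2 : finType := (T + bool)%type : finType.
Definition old x : plus2 := inl x.
Definition fresh (b : bool) : plus2 := inr b.

Variant plus2_spec : plus2 -> Type :=
| Old x : plus2_spec (old x)
| Fresh b : plus2_spec (fresh b).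

Lemma plus2P (z : plus2) : plus2_spec z.
Proof. by case: z => [x|b]; [exact: (Old x)|exact: (Fresh b)]. Qed.

Lemma old_inj : injective old. Proof. by move=> x y []. Qed.
Lemma fresh_inj : injective fresh. Proof. by move=> x y []. Qed.

Definition add2_fun (s : T -> T) (z : plus2) : plus2 :=
  match z with inl x => old (s x) | inr b => fresh b end.

Lemma add2_inj s : injective (add2_fun s).
Proof. by move=> [x|b] [y|d] //= [] /perm_inj ->. Qed.

Definition add2 s : {perm plus2} := perm (@add2_inj s).

Lemma add2E s x : add2 s (old x) = old (s x). Proof. by rewrite permE. Qed.
Lemma add2r s b : add2 s (fresh b) = fresh b. Proof. by rewrite permE. Qed.

Lemma add2M s u : add2 (s * u)%g = (add2 s * add2 u)%g.
Proof.
by apply/permP => z; case: (plus2P z) => x; rewrite permM !(add2E, add2r) ?permM.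
Qed.

Lemma add2_1 : add2 1%g = 1%g.
Proof.
by apply/permP => z; case: (plus2P z) => x; rewrite ?(add2E, add2r) !perm1.
Qed.

Lemma add2V s : (add2 s)^-1%g = add2 (s^-1)%g.
Proof.
by apply/eqP; rewrite eq_invg_mul -add2M mulgV add2_1.
Qed.

Lemma add2X s n x : (add2 s ^+ n)%g (old x) = old ((s ^+ n)%g x).
Proof.
by elim: n => [|n IHn]; rewrite ?expg0 ?perm1 // !expgSr !permM IHn add2E.
Qed.

Lemma porbit_add2 s x : porbit (add2 s) (old x) = [set old y | y in porbit s x].
Proof.
apply/setP => z; apply/porbitP/imsetP => [[i ->]|[y /porbitP[i ->] ->]].
  by exists ((s ^+ i)%g x); rewrite ?mem_porbit ?add2X.
by exists i; rewrite add2X.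
Qed.

Lemma porbit_add2r s b : porbit (add2 s) (fresh b) = [set fresh b].
Proof.
apply/setP => z; rewrite inE; apply/idP/eqP => [|->]; last exact: porbit_id.
by apply: contraTeq => zb; apply: notin_porbit_fix; rewrite ?add2r.
Qed.

(** The cycles are the images of the old ones and the two new singletons. *)
Lemma card_porbits_add2 s : #|porbits (add2 s)| = #|porbits s| + 2.
Proof.
pose I (c : {set T}) : {set plus2} := [set old y | y in c].
have Iinj : injective I by apply: imset_inj; apply: old_inj.
have -> : porbits (add2 s) =
    (I @: porbits s) :|: [set [set fresh b] | b in [set: bool]].
  apply/setP => c; rewrite inE; apply/imsetP/orP => [[z _ ->]|].
    case: (plus2P z) => [x|b].
      by left; rewrite porbit_add2; apply: imset_f; apply: imset_f.
    by right; rewrite porbit_add2r; apply: imset_f.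
  case=> [/imsetP[_ /imsetP[x _ ->] ->]|/imsetP[b _ ->]].
    by exists (old x); rewrite ?porbit_add2.
  by exists (fresh b); rewrite ?porbit_add2r.
rewrite cardsU (card_imset _ Iinj) [X in _ + X]card_imset; last first.
  by move=> b d /finset.set1_inj/fresh_inj.
rewrite cardsT card_bool (_ : _ :&: _ = finset.set0) ?cards0 ?subn0 //.
apply/setP => c; rewrite !inE; apply/negP => /andP[/imsetP[d _ ->] /imsetP[b _]].
by move/setP/(_ (fresh b)); rewrite !inE eqxx => /imsetP[].
Qed.

End AddTwoPoints.

(** * Counting cycles after the new points are spliced in *)

Section Faces.
Variables (T : finType).
Implicit Types (s : {perm T}) (m : {perm plus2 T}) (x y : T).

Lemma porbit_inl s m x y : (forall z, old (s z) \in porbit m (old z)) ->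
  y \in porbit s x -> old y \in porbit m (old x).
Proof.
move=> sm /porbitP[i ->]; elim: i => [|i IHi]; first by rewrite perm1 porbit_id.
rewrite expgSr permM; move: IHi; rewrite -eq_porbit_mem => /eqP <-; exact: sm.
Qed.

(** Conjugation by [add2 s] brings the transposition to the front, where it merges a fixed point
    into another cycle: two cycles are gained and one is lost. *)
Lemma card_porbits_add2_tperm s u (b : T) i :
  #|porbits (add2 s * tperm (old b) (fresh _ i) * add2 u)%g|
    = #|porbits (s * u)%g|.+1.
Proof.
apply: succn_inj; rewrite [(add2 s * _)%g]conjgCV add2V tpermJ add2E add2r -mulgA -add2M.
rewrite porbits_merge ?card_porbits_add2 ?addn2 //.
by apply: notin_porbit_fix; rewrite ?add2r.
Qed.

Lemma card_porbits_add2_tperm2 s u (a b : T) i j : i != j ->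
  #|porbits (add2 s *
      (tperm (old a) (fresh _ i) * tperm (old b) (fresh _ j)) * add2 u)%g|
    = #|porbits (s * u)%g|.
Proof.
move=> ij; apply: succn_inj.
rewrite mulgA [(add2 s * _)%g]conjgCV add2V tpermJ add2E add2r -2!mulgA porbits_merge.
  by rewrite mulgA card_porbits_add2_tperm.
apply: notin_porbit_fix => //; rewrite !permM add2r tpermD ?add2r //.
by rewrite eq_sym; apply: contraNneq ij => /fresh_inj->.
Qed.

Lemma fpath_inl s m x p : (forall y, y \in belast x p -> m (old y) = old (s y)) ->
  fpath s x p -> fpath m (old x) (map (@old _) p).
Proof.
elim: p x => //= y p IHp x ms /andP[/eqP sx sp].
rewrite ms ?mem_head // sx eqxx /=; apply: IHp sp => z zp.
by apply: ms; rewrite inE zp orbT.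
Qed.

Lemma fcycle_inl s m x p : (forall y, y \in x :: p -> m (old y) = old (s y)) ->
  fcycle s (x :: p) -> fcycle m (old x :: map (@old _) p).
Proof.
move=> ms; rewrite /= !rcons_path => /andP[sp /eqP sl].
rewrite last_map /= ms ?mem_last // sl eqxx andbT; apply: fpath_inl sp => y yp.
by apply: ms; apply: mem_belast.
Qed.

End Faces.

(** * Drawing edges in the outer face *)

Section DiagramAxioms.
Variables (A : finType) (D : disc_diagram A).

Lemma doppK : involutive (dopp D). Proof. by case: D. Qed.
Lemma dopp_neq (d : D) : dopp D d != d. Proof. by case: D d. Qed.
Lemma dlabel_opp (d : D) : dlabel (dopp D d) = letter_inv (dlabel d).
Proof. by case: D d. Qed.
Lemma dconnect (d : D) :
  connect (fun x y => (y == dopp D x) || (y == dnext D x)) (dbase D) d.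
Proof. by case: D d. Qed.
Lemma deuler : #|porbits (dopp D * dnext D)%g| + #|porbits (dnext D)|
  = #|porbits (dopp D)| + 2.
Proof. by case: D. Qed.

Lemma face_wordE (d : D) c : uniq (d :: c) -> fcycle (dnext D) (d :: c) ->
  face_word d = map (@dlabel A D) (d :: c).
Proof. by move=> Uc Cc; rewrite /face_word (fcycle_porbit Uc Cc). Qed.

Lemma face_traject (d : D) : exists c,
  [/\ uniq (d :: c), fcycle (dnext D) (d :: c), porbit (dnext D) d =i d :: c
    & face_word d = map (@dlabel A D) (d :: c)].
Proof.
have := card_porbit_neq0 (dnext D) d; have := uniq_traject_porbit (dnext D) d.
have := traject_porbit_fcycle (dnext D) d; have := porbit_traject (dnext D) d.
rewrite /face_word; case: #|_| => // n; rewrite trajectS.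
by set c := traject _ _ _ => *; exists c.
Qed.

Lemma num_cellsE : (num_cells (VKDisc D)).+1 = #|porbits (dnext D)|.
Proof.
rewrite /= [RHS](cardsD1 (outer_face D)).
by rewrite /outer_face imset_f //= add1n.
Qed.

End DiagramAxioms.

(* Drawing an edge in the outer face: the new dart [fresh false] reads [l], its
   reverse is [fresh true], and [P] says after which old darts they are placed. *)
Section NewEdge.
Variables (A : finType) (D : disc_diagram A) (l : letter A).
Variable P : {perm plus2 D}.

Definition newopp : {perm plus2 D} :=
  (add2 (dopp D) * tperm (fresh _ false) (fresh _ true))%g.
(** The leading transposition cancels the one in [newopp], so that in the vertex permutation
    [newopp * newnext] only [P] stands between the old [dopp] and [dnext]. *)
Definition newnext : {perm plus2 D} :=
  (tperm (fresh _ false) (fresh _ true) * P * add2 (dnext D))%g.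
Definition newlabel (x : plus2 D) : A * bool :=
  match x with inl d => dlabel d | inr b => (l.1, l.2 (+) b) end.
Let newrel := [rel x y | (y == newopp x) || (y == newnext x)].

Hypothesis next_connected :
  forall d, connect newrel (old d) (old (dnext D d)).
Hypothesis new_attached : exists d, newnext (old d) = fresh _ false.
Hypothesis new_euler :
  #|porbits (add2 (dopp D) * P * add2 (dnext D))%g| + #|porbits newnext|
    = (#|porbits (dopp D * dnext D)%g| + #|porbits (dnext D)|).+1.

Lemma newoppl d : newopp (old d) = old (dopp D d).
Proof. by rewrite permM add2E tpermD. Qed.

Lemma newoppr b : newopp (fresh _ b) = fresh _ (~~ b).
Proof. by rewrite permM add2r; case: b; rewrite ?tpermL ?tpermR. Qed.

Fact newoppK x : newopp (newopp x) = x.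
Proof. by case: (plus2P x) => [d|b]; rewrite ?(newoppl, newoppr) ?doppK ?negbK. Qed.

Fact newopp_neq x : newopp x != x.
Proof.
case: (plus2P x) => [d|[]]; rewrite ?newoppr // newoppl.
by rewrite (inj_eq (@old_inj _)) dopp_neq.
Qed.

Fact newlabel_opp x : newlabel (newopp x) = letter_inv (newlabel x).
Proof.
case: (plus2P x) => [d|b]; rewrite ?newoppr ?newoppl /= ?dlabel_opp //.
by rewrite /letter_inv /= addbN.
Qed.

Fact newconnect x :
  connect (fun x y => (y == newopp x) || (y == newnext x)) (old (dbase D)) x.
Proof.
have oldC d : connect newrel (old (dbase D)) (old d).
  have /connectP[p + ->] := dconnect d.
  elim/last_ind: p => [|p y IHp] //.
  rewrite rcons_path last_rcons => /andP[/IHp pC /orP[]/eqP->];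
    apply: connect_trans pC _ => //.
  by apply: connect1; rewrite /= newoppl eqxx.
case: (plus2P x) => [d|]; first exact: oldC.
have eC : connect newrel (old (dbase D)) (fresh _ false).
  case: new_attached => d <-; apply: connect_trans (oldC d) _.
  by apply: connect1; rewrite /= eqxx orbT.
case=> //; apply: connect_trans eC _; apply: connect1.
by rewrite /= newoppr eqxx.
Qed.

(** The two new darts form one more edge, and by [new_euler] vertices and faces together also grow
    by one. *)
Fact neweuler : #|porbits (newopp * newnext)%g| + #|porbits newnext|
  = #|porbits newopp| + 2.
Proof.
have -> : (newopp * newnext = add2 (dopp D) * P * add2 (dnext D))%g.
  by rewrite /newopp /newnext -!mulgA (mulgA (tperm _ _) (tperm _ _)) tperm2 mul1g.
rewrite new_euler deuler; apply: succn_inj.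
have -> : newopp = (tperm (fresh _ false) (fresh _ true) * add2 (dopp D))%g.
  apply/permP => x; rewrite !permM.
  case: (plus2P x) => [d|[]]; rewrite ?add2E ?add2r ?tpermL ?tpermR ?add2r //.
  by rewrite !tpermD // add2E.
rewrite -[RHS]addSn porbits_merge ?card_porbits_add2 ?addn2 //.
by apply: notin_porbit_fix; rewrite ?add2r.
Qed.

Definition new_diagram : disc_diagram A :=
  DiscDiagram newoppK newopp_neq newlabel_opp newconnect neweuler.

(** The edge is drawn inside the outer face, so every other face keeps its cycle of darts and hence
    its relator. *)
Lemma new_diagram_cells rels (d : D) :
  (forall x, x \notin outer_face D -> newnext (old x) = old (dnext D x)) ->
  diagram_over rels (VKDisc D) -> d \notin outer_face D ->
  exists2 d' : new_diagram, d' \in porbit (dnext new_diagram) (old d) &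
    (face_word d' \in rels) || (word_inv (face_word d') \in rels).
Proof.
move=> nx_old Dr dN; have [] := Dr (porbit (dnext D) d).
  rewrite !inE imset_f // andbT; apply: contra dN => /eqP <-; exact: porbit_id.
move=> x xd xr; have old_cycle y : y \in porbit (dnext D) d -> exists c,
    [/\ uniq (old y :: map (@old _) c : seq new_diagram),
      fcycle (dnext new_diagram) (old y :: map (@old _) c),
      porbit (dnext D) y =i y :: c
    & face_word y = map (@dlabel A D) (y :: c)].
  move=> yd; have [c [Uc Cc pc fc]] := face_traject y; exists c; split => //.
    by rewrite -map_cons map_inj_uniq //; apply: old_inj.
  apply: (fcycle_inl _ Cc) => z; rewrite -pc => zy; apply: nx_old.
  apply: contra dN; rewrite /outer_face -!eq_porbit_mem => /eqP <-.
  by rewrite eq_sym; move: yd zy; rewrite -!eq_porbit_mem => /eqP -> /eqP ->.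
exists (old x); have [c [Uc Cc pc fc]] := old_cycle x xd.
  rewrite porbit_sym (porbit_fcycle Uc Cc) -map_cons mem_map; last exact: old_inj.
  by rewrite -pc porbit_sym.
suff -> : face_word (old x : new_diagram) = face_word x by [].
by rewrite (face_wordE Uc Cc) fc /= -map_comp.
Qed.

End NewEdge.

(** * Words bounding diagrams, and the moves on them *)

Section Filling.
Variables (A : finType) (rels : seq (word A)).
Implicit Types (u v w : word A) (l : letter A).

Definition fills w n := exists K,
  [/\ diagram_over rels K, boundary_word K = w & num_cells K <= n].

Lemma fills_nil : fills [::] 0.
Proof. by exists (VKPoint A). Qed.

Definition rebase (D : disc_diagram A) (b : D)
    (bC : forall d, connect (fun x y => (y == dopp D x) || (y == dnext D x)) b d) :=
  DiscDiagram (@doppK A D) (@dopp_neq A D) (@dlabel_opp A D) bC (@deuler A D).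

(** The base dart is moved [size u] steps along the outer face, which remains the same set of
    darts. *)
Lemma fills_rot u v n : fills (u ++ v) n -> fills (v ++ u) n.
Proof.
have [->|v0] := eqVneq v [::]; first by rewrite cats0.
case=> -[|D] [Dr Dw Dn].
  by move: Dw v0; case: (u) (v) => [|? ?] [].
pose b := iter (size u) (dnext D) (dbase D).
have bP : b \in porbit (dnext D) (dbase D).
  by rewrite /b -permX; exact: mem_porbit.
have bC d : connect (fun x y => (y == dopp D x) || (y == dnext D x)) b d.
  apply: (connect_trans _ (dconnect d)); move: bP; rewrite porbit_sym.
  case/porbitP=> i ->; elim: i => [|i IHi]; first by rewrite perm1.
  by apply: (connect_trans IHi); apply: connect1; rewrite expgSr permM eqxx orbT.
have bo : outer_face (rebase bC) = outer_face D.
  by apply/eqP; rewrite /outer_face eq_porbit_mem.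
have [c [Uc Cc pc fc]] := face_traject (dbase D).
have Ec : dbase D :: c = traject (dnext D) (dbase D) (size (dbase D :: c)).
  by rewrite -(fcycle_porbit Uc Cc) size_traject.
have us : size u < size (dbase D :: c).
  rewrite -(size_map (@dlabel A D)) -fc -[face_word _]/(boundary_word (VKDisc D)).
  by rewrite Dw size_cat -[X in X < _]addn0 ltn_add2l lt0n size_eq0.
exists (VKDisc (rebase bC)); split.
- by move=> c' c'P; apply: Dr; rewrite -bo.
- have Eb : b :: drop (size u).+1 (dbase D :: c) ++ take (size u) (dbase D :: c)
      = rot (size u) (dbase D :: c).
    rewrite /rot (drop_nth (dbase D) us); congr (_ :: _).
    by rewrite Ec (nth_traject _ us).
  have Ub := Uc; have Cb := Cc.
  rewrite -(rot_uniq (size u)) -Eb in Ub; rewrite -(rot_cycle (size u)) -Eb in Cb.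
  rewrite [LHS](face_wordE Ub Cb) Eb map_rot -fc.
  by rewrite -[face_word _]/(boundary_word (VKDisc D)) Dw rot_size_cat.
- by move: Dn; rewrite /= bo.
Qed.

(* Here the edge is drawn at the end of the boundary word: a pendant edge
   reading [l l^-1], or an edge cutting a cell off the outer face. *)
Lemma fills_hair w l n : fills w n -> fills (w ++ [:: l; letter_inv l]) n.
Proof.
case=> -[|D] [Dr Dw Dn].
  (* From the point, the hair is a single edge on the sphere: its darts are the two booleans, and
     negation is both [dopp] and [dnext]. There are two vertices, one edge and one face. *)
  have opp_neq (b : bool) : perm negb_inj b != b by rewrite permE; case: b.
  have oppK (b : bool) : perm negb_inj (perm negb_inj b) = b.
    by rewrite !permE negbK.
  have lab (b : bool) : (l.1, l.2 (+) perm negb_inj b) = letter_inv (l.1, l.2 (+) b).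
    by rewrite permE /letter_inv /= addbN.
  have conn (b : bool) : connect
      (fun x y => (y == perm negb_inj x) || (y == perm negb_inj x)) false b.
    by case: b => //; apply: connect1; rewrite permE.
  have c2 : uniq [:: false; true] by [].
  have f2 : fcycle (perm negb_inj) [:: false; true] by rewrite /= !permE.
  have eul : #|porbits (perm negb_inj * perm negb_inj)%g|
      + #|porbits (perm negb_inj)| = #|porbits (perm negb_inj)| + 2.
    rewrite addnC; congr (_ + _).
    have -> : (perm negb_inj * perm negb_inj = 1)%g.
      by apply/permP => b; rewrite permM perm1.
    rewrite card_imset ?card_bool // => x y.
    by move/eqP; rewrite eq_porbit_mem => /porbitP[i ->]; rewrite expg1n perm1.
  pose D := DiscDiagram oppK opp_neq lab conn eul.
  exists (VKDisc D); split.
  - move=> c /setD1P[cN /imsetP[b _ cE]]; case/eqP: cN; rewrite cE.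
    apply/eqP; rewrite eq_porbit_mem porbit_traject (fcycle_porbit c2 f2).
    by case: b {cE}.
  - rewrite [LHS](@face_wordE _ D _ _ c2 f2) -Dw /= addbF addbT.
    by case: (l).
  - apply: leq_trans (leq0n n); rewrite -ltnS (num_cellsE D).
    apply: (@leq_trans #|[set porbit (dnext D) false]|); last by rewrite cards1.
    apply: subset_leq_card;
      apply/fintype.subsetP => _ /imsetP[b _ ->]; rewrite inE eq_porbit_mem.
    by rewrite porbit_traject (fcycle_porbit c2 f2); case: b.
have [p [Up Cp pp fp]] := face_traject (dbase D).
move: Cp; rewrite /= rcons_path => /andP[Pp /eqP lp].
pose b := last (dbase D) p.
(* With this [P] the outer face runs from its last dart [b] through [fresh false] and [fresh true]
   back to the base dart. *)
pose P : {perm plus2 D} := tperm (old b) (fresh _ false).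
pose nx := newnext P.
have nx_old x : x != b -> nx (old x) = old (dnext D x).
  move=> xb; rewrite /nx /newnext !permM tpermD // tpermD ?add2E //.
  by rewrite (inj_eq (@old_inj _)) eq_sym.
have nxb : nx (old b) = fresh _ false.
  by rewrite /nx /newnext !permM tpermD // tpermL add2r.
have nxf : nx (fresh _ false) = fresh _ true.
  by rewrite /nx /newnext !permM tpermL tpermD // add2r.
have nxt : nx (fresh _ true) = old (dbase D).
  by rewrite /nx /newnext !permM !tpermR add2E lp.
have nC d : connect [rel x y | (y == newopp D x) || (y == nx x)]
    (old d) (old (dnext D d)).
  have [->|db] := eqVneq d b; last first.
    by apply: connect1; rewrite /= nx_old // eqxx orbT.
  rewrite lp; apply: (@connect_trans _ _ (fresh _ false)).
    by apply: connect1; rewrite /= nxb eqxx orbT.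
  apply: (@connect_trans _ _ (fresh _ true)).
    by apply: connect1; rewrite /= nxf eqxx orbT.
  by apply: connect1; rewrite /= nxt eqxx orbT.
(* Both new darts are merged into the outer face, so the number of faces is unchanged; it is the
   number of vertices that grows by one. *)
have cnx : #|porbits nx| = #|porbits (dnext D)|.
  have := card_porbits_add2_tperm 1 (dnext D) b false.
  rewrite add2_1 !mul1g => E; apply: succn_inj; rewrite -E /nx /newnext -mulgA.
  by apply: porbits_merge; apply: notin_porbit_fix;
    rewrite // permM tpermD // add2r.
have eul : #|porbits (add2 (dopp D) * P * add2 (dnext D))%g| + #|porbits nx|
    = (#|porbits (dopp D * dnext D)%g| + #|porbits (dnext D)|).+1.
  by rewrite card_porbits_add2_tperm cnx.
pose D' := new_diagram l nC (ex_intro _ b nxb) eul.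
have U' : uniq (old (dbase D) :: map (@old D) p ++ [:: fresh _ false; fresh _ true]).
  rewrite -cat_cons -map_cons cat_uniq map_inj_uniq ?Up //=; last exact: old_inj.
  by rewrite orbF andbT; apply/norP; split; apply/negP => /mapP[].
have C' : fcycle nx (old (dbase D) :: map (@old D) p ++ [:: fresh _ false; fresh _ true]).
  rewrite /= rcons_cat cat_path /= last_map nxb nxf nxt !eqxx !andbT.
  apply: (fpath_inl _ Pp) => y yp; apply: nx_old; apply: contraTneq yp => ->.
  by move: Up; rewrite lastI rcons_uniq => /andP[].
have oD' : outer_face D' =i _ := porbit_fcycle U' C'.
exists (VKDisc D'); split.
- move=> c /setD1P[+ /imsetP[z _ cE]]; rewrite {c}cE eq_porbit_mem oD'.
  case: (plus2P z) => [x|[]]; last 2 first.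
  + by rewrite inE mem_cat !inE eqxx !orbT.
  + by rewrite inE mem_cat !inE eqxx !orbT.
  move=> xN; apply: new_diagram_cells => // [y yN|].
    apply: nx_old; apply: contraNneq yN => ->; rewrite /outer_face pp.
    exact: mem_last.
  apply: contra xN; rewrite /outer_face pp -cat_cons -map_cons mem_cat mem_map.
    by move=> ->.
  exact: old_inj.
- rewrite [LHS](@face_wordE _ D' _ _ U' C') -Dw /= fp /= map_cat /= -map_comp.
  by rewrite addbF addbT; case: (l).
- by rewrite -ltnS (num_cellsE D') [porbits _]/(porbits nx) cnx -num_cellsE ltnS.
Qed.

(** The new edge runs from the end of [u] to the base point. It leaves [u l] on the outer face and
    cuts off a cell reading [l^-1 v]. A nonempty [u] keeps the base dart on the outer face, whereas
    [v] may be empty, the new edge then being a loop. *)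
Lemma fills_edge u v l n : u != [::] -> letter_inv l :: v \in rels ->
  fills (u ++ v) n -> fills (u ++ [:: l]) n.+1.
Proof.
move=> u0 rel [[|D] [Dr Dw Dn]]; first by case: (u) u0 Dw.
have [c [Uc Cc pc fc]] := face_traject (dbase D).
have [p [q [Ec uE vE]]] : exists p q, [/\ c = p ++ q,
    map (@dlabel A D) (dbase D :: p) = u & map (@dlabel A D) q = v].
  case: (u) u0 Dw => // x u' _; rewrite /= fc => -[<- cE].
  exists (take (size u') c), (drop (size u') c).
  by rewrite cat_take_drop map_take map_drop cE take_size_cat ?drop_size_cat.
move: Uc Cc pc; rewrite {c fc}Ec => Uc Cc pc.
move: Cc; rewrite /= rcons_path => /andP[Pp /eqP lp].
pose a := last (dbase D) p; pose b := last a q.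
have lpq : last (dbase D) (p ++ q) = b by rewrite last_cat.
rewrite lpq in lp.
have abq : (a == b) = (q == [::]).
  rewrite /b; case: (q) Uc => [|x q']; first by rewrite eqxx.
  rewrite -cat_cons cat_uniq => /and3P[_ /hasPn qp _]; apply/eqP => aE.
  by have /negP[] := qp _ (mem_last x q');
    rewrite -[last x q']/(last a (x :: q')) -aE mem_last.
(* After the last dart [a] of [u] comes [fresh false], closing the outer face; after the last dart
   [b] of [v] comes [fresh true], closing the cell. If [v] is empty then [a = b], and [fresh true]
   alone bounds the cell. *)
pose P : {perm plus2 D} :=
  (tperm (old a) (fresh _ false) * tperm (old b) (fresh _ true))%g.
pose nx := newnext P.
have nx_old x : x != a -> x != b -> nx (old x) = old (dnext D x).
  move=> xa xb; rewrite /nx /newnext !permM [tperm _ _ (old x)]tpermD //.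
  have oldN y : x != y -> old y != old x by rewrite (inj_eq (@old_inj _)) eq_sym.
  by rewrite [tperm _ _ (old x)]tpermD ?oldN // tpermD ?add2E ?oldN.
have nxa : nx (old a) = fresh _ false.
  rewrite /nx /newnext !permM [tperm _ _ (old a)]tpermD // tpermL tpermD ?add2r //.
have nxb : a != b -> nx (old b) = fresh _ true.
  move=> ab; rewrite /nx /newnext !permM [tperm _ _ (old b)]tpermD //.
  by rewrite [tperm (old a) _ _]tpermD ?(inj_eq (@old_inj _)) // tpermL add2r.
have nxf : nx (fresh _ false) = old (dbase D).
  by rewrite /nx /newnext !permM tpermL [tperm _ _ (fresh _ true)]tpermD //
    tpermR add2E lp.
have Pq : fpath (dnext D) a q by move: Pp; rewrite cat_path => /andP[].
have ab0 : q = [::] -> a = b by move/eqP; rewrite -abq => /eqP.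
have nxt : nx (fresh _ true) = if q is x :: _ then old x else fresh _ true.
  rewrite /nx /newnext !permM !tpermR.
  move: abq ab0 Pq; case: (q) => [|y q'] abN ba.
    by rewrite -ba // tpermL add2r.
  move=> /= /andP[/eqP ay _]; rewrite tpermD ?add2E ?ay // (inj_eq (@old_inj _)) eq_sym.
  by rewrite abN.
have nC d : connect [rel x y | (y == newopp D x) || (y == nx x)]
    (old d) (old (dnext D d)).
  have nxC x : connect [rel x y | (y == newopp D x) || (y == nx x)] x (nx x).
    by apply: connect1; rewrite /= eqxx orbT.
  have ofC i : connect [rel x y | (y == newopp D x) || (y == nx x)]
      (fresh _ i) (fresh _ (~~ i)).
    by apply: connect1; rewrite /= newoppr eqxx.
  have [->|da] := eqVneq d a.
    apply: (connect_trans (nxC _)); rewrite nxa.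
    have [q0|q0] := eqVneq q [::].
      by rewrite (ab0 q0) lp -nxf nxC.
    apply: (connect_trans (ofC _)); apply: (connect_trans (nxC _)); rewrite nxt.
    by case: (q) q0 Pq => //= x q' _ /andP[/eqP ->].
  have [->|db] := eqVneq d b; last by rewrite -nx_old.
  have [ab|ab] := eqVneq a b.
    by rewrite -ab (connect_trans (nxC _)) // nxa ab lp -nxf.
  apply: (connect_trans (nxC _)); rewrite nxb //.
  by rewrite (connect_trans (ofC _)) // lp -nxf.
have cnx : #|porbits nx| = #|porbits (dnext D)|.+1.
  have := @card_porbits_add2_tperm2 _ 1 (dnext D) a b false true isT.
  rewrite add2_1 !mul1g => E; rewrite -E /nx /newnext -mulgA.
  (* Under [m] both new darts lie on the old boundary cycle, so the leading transposition splits
     that cycle in two: one more face, and no new vertex. *)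
  set m := (P * add2 (dnext D))%g.
  have m_old x : x != a -> x != b -> m (old x) = old (dnext D x).
    by move=> xa xb; rewrite -nx_old // /nx /newnext -mulgA [RHS]permM tpermD.
  have ma : m (old a) = fresh _ false.
    by rewrite -nxa /nx /newnext -mulgA [RHS]permM tpermD.
  have mb : a != b -> m (old b) = fresh _ true.
    by move=> ab; rewrite -nxb // /nx /newnext -mulgA [RHS]permM tpermD.
  have mt : m (fresh _ true) = old (dbase D).
    by rewrite -nxf /nx /newnext -mulgA [RHS]permM tpermL.
  have mf : m (fresh _ false) = if q is x :: _ then old x else fresh _ true.
    by rewrite -nxt /nx /newnext -mulgA [RHS]permM tpermR.
  have in2 x y z : m x = y -> m y = z -> z \in porbit m x.
    by move=> <- <-; apply/porbitP; exists 2; rewrite expgS expg1 [RHS]permM.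
  apply: porbits_split => //.
  have [q0|q0] := eqVneq q [::].
    by rewrite porbit_sym; move: mf; rewrite q0 => <-; apply: in_porbit_fun.
  have ab : a != b by rewrite abq.
  have mC x : old (dnext D x) \in porbit m (old x).
    have [->|xa] := eqVneq x a.
      apply: in2 ma _; rewrite mf.
      by case: (q) q0 Pq => //= x' q' _ /andP[/eqP ->].
    have [->|xb] := eqVneq x b; first by rewrite lp; apply: in2 (mb ab) mt.
    by rewrite -m_old // in_porbit_fun.
  have abm : old a \in porbit m (old b).
    apply: porbit_inl mC _; rewrite porbit_sym.
    have ap : a \in porbit (dnext D) (dbase D).
      by rewrite pc -cat_cons mem_cat mem_last.
    have bp : b \in porbit (dnext D) (dbase D) by rewrite pc -lpq mem_last.
    exact: eq_porbit_in bp ap.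
  move: (in_porbit_fun m (old a)) (in_porbit_fun m (old b)) abm.
  by rewrite ma mb // -!eq_porbit_mem => /eqP-> /eqP-> /eqP->.
have eul : #|porbits (add2 (dopp D) * P * add2 (dnext D))%g| + #|porbits nx|
    = (#|porbits (dopp D * dnext D)%g| + #|porbits (dnext D)|).+1.
  by rewrite card_porbits_add2_tperm2 // cnx addnS.
pose D' := new_diagram l nC (ex_intro _ a nxa) eul.
have oldP x c : (old x \in map (@old D) c) = (x \in c).
  by rewrite mem_map //; apply: old_inj.
have freshP i c : fresh _ i \notin map (@old D) c.
  by apply/negP => /mapP[].
have U' : uniq (old (dbase D) :: rcons (map (@old D) p) (fresh _ false)).
  rewrite -!rcons_cons -map_cons rcons_uniq freshP map_inj_uniq; last exact: old_inj.
  by move: Uc; rewrite -cat_cons cat_uniq => /andP[].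
have V' : uniq (fresh _ true :: map (@old D) q).
  rewrite /= freshP map_inj_uniq; last exact: old_inj.
  by move: Uc; rewrite -cat_cons cat_uniq => /and3P[].
have Npq y : y \in dbase D :: p -> y \notin q.
  move: Uc; rewrite -cat_cons cat_uniq => /and3P[_ /hasPn pq _] yp.
  by apply: contraL yp => /pq.
have C' : fcycle nx (old (dbase D) :: rcons (map (@old D) p) (fresh _ false)).
  rewrite /= !rcons_path last_rcons last_map /= nxa nxf !eqxx !andbT.
  have Pp' : fpath (dnext D) (dbase D) p by move: Pp; rewrite cat_path => /andP[].
  apply: (fpath_inl _ Pp') => y yp.
  have ya : y != a.
    move: Uc; rewrite -cat_cons cat_uniq lastI rcons_uniq => /and3P[/andP[ya _] _ _].
    by apply: contraNneq ya => ya; rewrite -/a -ya.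
  apply: nx_old => //; apply: contraNneq ya => yb; rewrite yb.
  have [q0|q0] := eqVneq q [::]; first by rewrite (ab0 q0).
  have /negP[] := Npq _ (mem_belast yp); rewrite yb /b.
  by case: (q) q0 => //= x q' _; rewrite mem_last.
have W' : fcycle nx (fresh _ true :: map (@old D) q).
  rewrite /= rcons_path.
  have [q0|q0] := eqVneq q [::]; first by rewrite q0 /= nxt q0 eqxx.
  have ab : a != b by rewrite abq.
  have bE : last (fresh _ true) (map (@old D) q) = old b.
    by rewrite /b; case: (q) q0 => //= x q' _; rewrite last_map.
  rewrite bE /= nxb // eqxx andbT.
  have nxq y : y \in q -> y != b -> nx (old y) = old (dnext D y).
    move=> yq; apply: nx_old; apply: contraTneq yq => ->.
    by apply: Npq; apply: mem_last.
  have Uq : uniq q by move: V' => /= /andP[_]; rewrite map_inj_uniq //; apply: old_inj.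
  move: nxt Pq nxq Uq; rewrite /b; case: (q) q0 => //= x q' _ -> /andP[_ Pq] nxq Uq.
  rewrite eqxx; apply: (fpath_inl _ Pq) => y yq; apply: nxq; first exact: mem_belast.
  move: Uq; rewrite -[_ && _]/(uniq (x :: q')) lastI rcons_uniq => /andP[+ _].
  by apply: contraNneq => <-.
have oD' : outer_face D' =i _ := porbit_fcycle U' C'.
exists (VKDisc D'); split.
- move=> c /setD1P[+ /imsetP[z _ cE]]; rewrite {c}cE eq_porbit_mem oD'.
  have newface d : d \in fresh _ true :: map (@old D) q ->
      exists2 d' : D', d' \in porbit (dnext D') d &
        (face_word d' \in rels) || (word_inv (face_word d') \in rels).
    move=> dq; exists (fresh _ true).
      by rewrite porbit_sym (porbit_fcycle V' W').
    rewrite (@face_wordE _ D' _ _ V' W') /= -map_comp addbT.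
    by move: rel; rewrite /letter_inv -vE => ->.
  case: (plus2P z) => [x|[]]; last 2 first.
  + by move=> _; apply: newface; rewrite mem_head.
  + by rewrite inE mem_rcons mem_head orbT.
  move=> xN; have [xq|xNq] := boolP (x \in q).
    by apply: newface; rewrite inE oldP xq orbT.
  apply: new_diagram_cells => // [y yN|].
    have yc : y \notin dbase D :: p ++ q by rewrite -pc.
    apply: nx_old; apply: contraNneq yc => ->; last by rewrite -lpq mem_last.
    by rewrite -cat_cons mem_cat mem_last.
  apply: contra xN; rewrite /outer_face pc -cat_cons mem_cat (negbTE xNq) orbF.
  by rewrite -rcons_cons -map_cons mem_rcons inE oldP => ->; rewrite orbT.
- rewrite [LHS](@face_wordE _ D' _ _ U' C') -uE /= map_rcons -map_comp /= addbF.
  by rewrite cats1; case: (l).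
- rewrite -ltnS (num_cellsE D') [porbits _]/(porbits nx) cnx -num_cellsE.
  by rewrite !ltnS.
Qed.

End Filling.

(** * Fillings and exchanges of subwords *)

Section Words.
Variables (A : finType) (G : groupType) (phi : A -> G).
Implicit Types (u v w : word A) (l : letter A).

Lemma eval_cat u v : eval phi (u ++ v) = (eval phi u * eval phi v)%g.
Proof. by elim: u => [|l u IHu] /=; rewrite ?mul1g // IHu mulgA. Qed.

Lemma letter_invK l : letter_inv (letter_inv l) = l.
Proof. by case: l => a b; rewrite /letter_inv /= negbK. Qed.

Lemma eval_letter_inv l :
  eval_letter phi (letter_inv l) = (eval_letter phi l)^-1%g.
Proof. by case: l => a []; rewrite /eval_letter /= ?invgK. Qed.

Lemma word_inv_rcons u l : word_inv (rcons u l) = letter_inv l :: word_inv u.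
Proof. by rewrite /word_inv map_rcons rev_rcons. Qed.

Lemma word_invK u : word_inv (word_inv u) = u.
Proof.
rewrite /word_inv map_rev revK -map_comp -[RHS]map_id.
by apply: eq_map => l; apply: letter_invK.
Qed.

Lemma size_word_inv u : size (word_inv u) = size u.
Proof. by rewrite size_rev size_map. Qed.

Lemma eval_inv u : eval phi (word_inv u) = (eval phi u)^-1%g.
Proof.
elim/last_ind: u => [|u l IHu]; first by rewrite invg1.
by rewrite word_inv_rcons /= IHu -cats1 eval_cat /= mulg1 invMg eval_letter_inv.
Qed.

Lemma eval_eq_inv u v : eval phi u = eval phi v -> eval phi (word_inv u ++ v) = 1%g.
Proof. by move=> uv; rewrite eval_cat eval_inv uv mulVg. Qed.

End Words.

(* The moves building a diagram outwards, one edge at a time; [P w n] is to be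
   read as: [w] bounds a diagram with at most [n] cells. *)
Record filling_closed (A : finType) (rels : seq (word A))
    (P : word A -> nat -> Prop) := FillingClosed {
  fc_nil : P [::] 0;
  fc_mono w m n : m <= n -> P w m -> P w n;
  fc_rot u v n : P (u ++ v) n -> P (v ++ u) n;
  fc_hair w l n : P w n -> P (w ++ [:: l; letter_inv l]) n;
  fc_edge u v l n : u != [::] -> letter_inv l :: v \in rels ->
    P (u ++ v) n -> P (u ++ [:: l]) n.+1 }.

Lemma fills_closed (A : finType) (rels : seq (word A)) :
  filling_closed rels (fills rels).
Proof.
split; [exact: fills_nil| |exact: fills_rot|exact: fills_hair|exact: fills_edge].
by move=> w m n mn [K [Kr Kw Kn]]; exists K; split => //; apply: leq_trans mn.
Qed.

(** * The normal closure under the same moves *)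

Section NormalClosure.
Variables (A : finType) (rels : seq (word A)).
Implicit Types (u v w : word A).

Lemma normal_closure_cancel u v w :
  normal_closure rels (u ++ v ++ word_inv v ++ w) -> normal_closure rels (u ++ w).
Proof.
elim/last_ind: v u w => [|v l IHv] u w //.
rewrite word_inv_rcons -cats1 -!catA => H; apply: (IHv).
move: H; rewrite (catA u v) => H; rewrite (catA u v).
by apply: (@NCcancel _ _ _ l).
Qed.

Lemma normal_closure_rot u v :
  normal_closure rels (u ++ v) -> normal_closure rels (v ++ u).
Proof.
rewrite -[u in u ++ v]word_invK => /(NCconj (word_inv u)); rewrite -!catA.
by move/(@normal_closure_cancel [::]); rewrite word_invK.
Qed.

(** Reading the moves in the normal closure lets one combing argument give both the finite
    presentation and the area bound. For the edge move, [l^-1 v] yields [v^-1 l], and [u v v^-1 l]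
    cancels to [u l]. *)
Lemma normal_closure_closed : filling_closed rels (fun w _ => normal_closure rels w).
Proof.
split=> // [||w l _ H|u v l _ u0 rel H].
- exact: NC1.
- by move=> u v _; apply: normal_closure_rot.
- by have := @NCinsert _ _ w l [::]; rewrite cats0; apply.
have R : normal_closure rels (word_inv v ++ [:: l]).
  apply: normal_closure_rot; rewrite /= -{1}[l]letter_invK -word_inv_rcons.
  by apply: NCinv; rewrite -cats1; apply: (@normal_closure_rot [:: _]); apply: NCrel.
by have := NCmul H R; rewrite -catA; apply: normal_closure_cancel.
Qed.

End NormalClosure.

Lemma eval_normal_closure (A : finType) (G : groupType) (phi : A -> G) rels w :
  (forall r, r \in rels -> eval phi r = 1%g) ->
  normal_closure rels w -> eval phi w = 1%g.
Proof.
move=> rel1; have ll l : (eval_letter phi l * eval_letter phi (letter_inv l) = 1)%g.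
  by rewrite eval_letter_inv mulgV.
elim=> {w} [r /rel1 //|//|u v _ Hu _ Hv|u _ Hu|c u _ Hu|u l v _|u l v _].
- by rewrite eval_cat Hu Hv mulg1.
- by rewrite eval_inv Hu invg1.
- by rewrite !eval_cat eval_inv Hu mul1g mulgV.
- by rewrite !eval_cat /= mulg1 ll mul1g.
- by rewrite !eval_cat /= mulg1 ll mul1g.
Qed.

(** * Exchanging subwords of a boundary *)

Section Exchange.
Variables (A : finType) (G : groupType) (phi : A -> G).
Variables (rels : seq (word A)) (N : nat).
Hypothesis relsP : forall w,
  (w \in rels) = (size w <= N) && (eval phi w == 1%g).
Variable P : word A -> nat -> Prop.
Hypothesis Pc : filling_closed rels P.
Implicit Types (u v w s : word A) (l : letter A).

(* The context [u] is kept of length at least 2 so that the boundary never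
   becomes too short for [fc_edge]. *)
Definition exch v s m := forall u n, 1 < size u ->
  (P (u ++ v) n -> P (u ++ s) (n + m)) /\ (P (u ++ s) n -> P (u ++ v) (n + m)).

Lemma exch_sym v s m : exch v s m -> exch s v m.
Proof. by move=> H u n u1; have [] := H u n u1. Qed.

Lemma exch_mono m n v s : m <= n -> exch v s m -> exch v s n.
Proof.
move=> mn H u i u1; have [H1 H2] := H u i u1.
by split=> [/H1|/H2]; apply: (fc_mono Pc); rewrite leq_add2l.
Qed.

Lemma exch_refl v : exch v v 0.
Proof. by move=> u n _; rewrite addn0. Qed.

Lemma exch_trans s v w m n : exch v s m -> exch s w n -> exch v w (m + n).
Proof.
move=> H K u i u1; split; rewrite addnA.
  by move=> /(H u i u1).1 /(K u _ u1).1.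
by move=> /(K u i u1).2 /(H u _ u1).2; rewrite addnAC.
Qed.

(** Boundaries may be rotated, so the surrounding [x] and [y] are absorbed into the context. *)
Lemma exch_ctx x y v s m : exch v s m -> exch (x ++ v ++ y) (x ++ s ++ y) m.
Proof.
move=> H u n u1; have yux : 1 < size (y ++ u ++ x).
  by rewrite !size_cat addnA addnAC (leq_trans u1) // leq_addl.
have [H1 H2] := H _ n yux.
by split=> K; rewrite !catA; apply: (fc_rot Pc); rewrite -!catA;
  [move: H1|move: H2]; rewrite -!catA; apply; apply: (fc_rot Pc); rewrite -!catA.
Qed.

(** A hair is grown letter by letter, after rotating its tip to the end of the boundary; no cell is
    spent. *)
Lemma fc_insert u x v n : P (u ++ v) n -> P (u ++ x ++ word_inv x ++ v) n.
Proof.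
elim/last_ind: x u v => [|x l IHx] u v // /IHx K.
rewrite word_inv_rcons -cats1 /= -!catA.
have H : P ((word_inv x ++ v) ++ u ++ x) n.
  by apply: (fc_rot Pc); rewrite -!catA.
have {}H : P ((word_inv x ++ v) ++ (u ++ x ++ [:: l; letter_inv l])) n.
  by have := fc_hair Pc l H; rewrite -!catA.
by have := fc_rot Pc H; rewrite -!catA.
Qed.

(** Write [s] as [s' l]. A hair turns [u v] into [u s' s'^-1 v], and a single edge [l] then cuts off
    the cell [l^-1 s'^-1 v], whose length is that of [v] and [s] together. *)
Lemma fc_exchange u v s n : u != [::] -> s != [::] ->
  size v + size s <= N -> eval phi v = eval phi s ->
  P (u ++ v) n -> P (u ++ s) n.+1.
Proof.
move=> u0; case/lastP: s => // s l _ sN vs K.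
rewrite -cats1 catA; apply: (fc_edge Pc (v := word_inv s ++ v)).
- by case: (u) u0.
- rewrite -cat_cons -word_inv_rcons relsP size_cat size_word_inv addnC sN /=.
  exact/eqP/eval_eq_inv.
by rewrite -catA; apply: fc_insert.
Qed.

Lemma exch_half u v s n : size v + size s + 2 <= N ->
  eval phi v = eval phi s -> 1 < size u -> P (u ++ v) n -> P (u ++ s) n.+1.
Proof.
have [->|s0] := eqVneq s [::] => vsN vs; last first.
  move=> u1; apply: fc_exchange => //; first by case: (u) u1.
  by apply: leq_trans vsN; rewrite leq_addr.
(* For empty [s] the last letter [x] of the context is redrawn, the cell reading [x^-1 x v]. This
   explains the [+ 2] in the length bound; what is left of the context must still be nonempty. *)
case/lastP: u => // u x; rewrite size_rcons ltnS => u1.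
rewrite -cats1 -catA => K; rewrite cats0; apply: (fc_edge Pc _ _ K).
  by case: (u) u1.
rewrite relsP /= -[_.+2]addn2 (leq_trans _ vsN) ?leq_add2r ?leq_addr //=.
by rewrite vs /= mulg1 eval_letter_inv mulVg.
Qed.

Lemma exch_basic v s : size v + size s + 2 <= N ->
  eval phi v = eval phi s -> exch v s 1.
Proof.
move=> vsN vs u n u1; rewrite addn1; split; apply: exch_half => //.
by rewrite [size s + _]addnC.
Qed.

(* A pair of letters [l l^-1] serves as the context, and is removed at the cost
   of one cell. *)
Lemma exch_nil_filling w m : (forall a, phi a != 1%g) -> 3 < N ->
  eval phi w = 1%g -> exch [::] w m -> P w m.+1.
Proof.
move=> phi1 N3 w1 H; case: w w1 H => [|l w] w1 H.
  exact: (fc_mono Pc (leq0n _) (fc_nil Pc)).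
have := (H [:: l; letter_inv l] 0 isT).1 (fc_hair Pc l (fc_nil Pc)).
rewrite add0n => /(fc_rot Pc); case/lastP: w w1 {H} => [|w x] w1.
  move: w1 (phi1 l.1); rewrite /= mulg1 /eval_letter; case: ifP => _ /eqP.
    by rewrite invg_eq1 => ->.
  by move=> ->.
(* The last letter [x] is redrawn, and the cell [x^-1 x l l^-1] of length 4 swallows the auxiliary
   pair. *)
rewrite -cats1 -cat_cons -catA; apply: (fc_edge Pc) => //.
rewrite relsP N3 /= mulg1 eval_letter_inv mulKg.
by rewrite eval_letter_inv mulgV.
Qed.

End Exchange.

Lemma leastP (P : set nat) : (exists n, P n) -> is_least P (least P).
Proof.
move=> [n Pn]; apply: (@xgetPex _ 0 [set m | is_least P m]).
have ex : exists m, `[< P m >] by exists n; apply/asboolP.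
case: (ex_minnP ex) => m /asboolP Pm mmin; exists m; split => // i Pi.
exact/mmin/asboolP.
Qed.

Lemma least_le (P : set nat) n : P n -> least P <= n.
Proof. by move=> Pn; apply: (leastP _).2 => //; exists n. Qed.

(** * Combing *)

Section Paths.
Variables (G : groupType) (X : {fset G}).
Definition step (a : G) := (a == 1%g) || Xpm X a.

Lemma path_length_end p (g h : G) t : is_path X p g h -> path_length p h <= t -> p t = h.
Proof. by case=> _ _ /leastP[+ _]; apply. Qed.

Lemma path_step p (g h : G) t : is_path X p g h -> step ((p t)^-1 * p t.+1)%g.
Proof.
case=> _ /(_ t)[->|/andP[_ pX]] _; first by rewrite /step mulVg eqxx.
by rewrite /step pX orbT.
Qed.

Variables (A : finType) (phi : A -> G).
Hypothesis phi1 : forall a, phi a != 1%g.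
Hypothesis phiX : forall l : letter A, Xpm X (eval_letter phi l).
Hypothesis Xphi : forall x, Xpm X x -> x != 1%g ->
  exists l : letter A, eval_letter phi l = x.

(** A pause reads the empty word; the last default is never reached when [a] is a step. *)
Definition step_word (a : G) : word A :=
  if a == 1%g then [::] else
  if [pick l : A * bool | eval_letter phi l == a] is Some l then [:: l] else [::].

Lemma size_step_word a : size (step_word a) <= 1.
Proof. by rewrite /step_word; case: ifP => // _; case: pickP. Qed.

Lemma step_word1 : step_word 1%g = [::].
Proof. by rewrite /step_word eqxx. Qed.

Lemma eval_step_word a : step a -> eval phi (step_word a) = a.
Proof.
rewrite /step /step_word; case: (eqVneq a 1%g) => [-> //|a1 /= aX].
case: pickP => [l /eqP <-|]; first by rewrite /= mulg1.
by have [l <-] := Xphi aX a1; move/(_ l); rewrite eqxx.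
Qed.

Definition path_word (p : nat -> G) i n : word A :=
  flatten [seq step_word ((p t)^-1 * p t.+1)%g | t <- iota i n].

Lemma path_wordD p i m n :
  path_word p i (m + n) = path_word p i m ++ path_word p (i + m) n.
Proof. by rewrite /path_word iotaD map_cat flatten_cat. Qed.

Lemma path_word1 p i : path_word p i 1 = step_word ((p i)^-1 * p i.+1)%g.
Proof. by rewrite /path_word /= cats0. Qed.

Lemma size_path_word p i n : size (path_word p i n) <= n.
Proof.
elim: n => // n IHn; rewrite -addn1 path_wordD size_cat leq_add //.
by rewrite path_word1 size_step_word.
Qed.

Lemma eval_path_word p g h i n : is_path X p g h ->
  eval phi (path_word p i n) = ((p i)^-1 * p (i + n))%g.
Proof.
move=> Pp; elim: n => [|n IHn]; first by rewrite addn0 mulVg.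
rewrite -{1}addn1 path_wordD eval_cat IHn path_word1 eval_step_word.
  by rewrite -mulgA mulKVg addnS.
exact: path_step Pp.
Qed.

(** Beyond its length a path only pauses, and pauses read nothing. Two combing paths can therefore
    be read over a common time interval. *)
Lemma path_word_stable p g h n : is_path X p g h -> path_length p h <= n ->
  path_word p 0 n = path_word p 0 (path_length p h).
Proof.
move=> Pp pn; rewrite -(subnKC pn) path_wordD.
suff -> : forall m, path_word p (0 + path_length p h) m = [::] by rewrite cats0.
elim=> // m IHm; rewrite -addn1 path_wordD IHm path_word1.
by rewrite !(path_length_end Pp) ?mulVg ?step_word1 // ?leqW ?leq_addr.
Qed.

Lemma word_metric_eval (u : word A) : word_metric X 1%g (eval phi u) <= size u.
Proof.
apply: least_le; rewrite -[eval phi u]mul1g; move: 1%g.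
elim: u => [|l u IHu] g; first by exists [::]; rewrite /= mulg1.
have [s [Ps ls ss]] := IHu (g * eval_letter phi l)%g.
exists ((g * eval_letter phi l)%g :: s); split; rewrite /= ?ls ?mulgA ?ss //.
rewrite Ps andbT /cayley_adj mulKg phiX andbT -{1}[g]mulg1.
rewrite (inj_eq (@mulgI _ g)) eq_sym /eval_letter.
by case: (l.2); rewrite ?invg_eq1.
Qed.

Variables (R : realType) (sigma : G -> G -> nat -> G) (M : nat) (k : R).
Let len g h := path_length (sigma g h) h.
Hypothesis sigmaP : bicombing X sigma.
Hypotheses (M1 : 1 < M) (k2 : (2 < k)%R).
Hypothesis len_diag : forall g, ((len g g)%:R <= M%:R * k / 2 :> R)%R.
Hypothesis narrow : forall g h a b t, step a -> step b ->
  ((len (sigma g h t) (sigma (g * a)%g (h * b)%g t))%:R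
    <= Num.max (((len g h)%:R + (len (g * a)%g (h * b)%g)%:R) / k) (M%:R / 2) :> R)%R.

Definition comb_word g h := path_word (sigma g h) 0 (len g h).

Lemma size_comb_word g h : size (comb_word g h) <= len g h.
Proof. exact: size_path_word. Qed.

Lemma eval_comb_word g h : eval phi (comb_word g h) = (g^-1 * h)%g.
Proof.
rewrite (eval_path_word _ _ (sigmaP g h)).
rewrite [sigma g h (0 + _)](path_length_end (sigmaP g h)) //.
by case: (sigmaP g h) => ->.
Qed.

Lemma k_gt0 : (0 < k)%R. Proof. by apply: lt_trans k2. Qed.

(** This is narrowness at time 0 for [sigma g g] and [sigma (g a) (g a)]: their lengths sum to at
    most [M k], so both terms of the maximum are at most [M]. *)
Lemma len_step g a : step a -> len g (g * a)%g <= M.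
Proof.
move=> sa; have := narrow g g 0 sa sa.
have [-> _ _] := sigmaP g g; have [-> _ _] := sigmaP (g * a)%g (g * a)%g.
rewrite -(ler_nat R) => H; apply: (le_trans H); rewrite ge_max; apply/andP; split.
  have := len_diag g; have := len_diag (g * a)%g.
  rewrite ler_pdivrMr ?k_gt0 //; lra.
rewrite ler_pdivrMr // ler_peMr //; lra.
Qed.

Variables (rels : seq (word A)) (P : word A -> nat -> Prop).
Hypothesis relsP : forall w,
  (w \in rels) = (size w <= M.*2 + 4) && (eval phi w == 1%g).
Hypothesis Pc : filling_closed rels P.

Lemma exch_small v s : size v <= M.+1 -> size s <= M.+1 ->
  eval phi v = eval phi s -> exch P v s 1.
Proof. by move=> vM sM; apply: (exch_basic relsP Pc); lia. Qed.

(* The quadrilateral with sides [sigma g h], [b], [a] and [sigma (g a) (h b)] is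
   cut by the combing paths joining the two combings at equal times; each piece
   has sides shorter by the factor [2 / k]. *)
Lemma exch_quad L j g h a b (e : R) : step a -> step b -> M <= L ->
  len g h <= L -> len (g * a)%g (h * b)%g <= L ->
  ((len g h)%:R <= e)%R -> ((len (g * a)%g (h * b)%g)%:R <= e)%R ->
  (e * (2 / k) ^+ j <= M%:R)%R ->
  exch P (comb_word g h ++ step_word b)
    (step_word a ++ comb_word (g * a)%g (h * b)%g) ((L + 2) ^ j).
Proof.
elim: j g h a b e => [|j IHj] g h a b e sa sb ML pL qL pe qe eM.
  rewrite expr0 mulr1 in eM; rewrite expn0; apply: exch_small.
  - rewrite size_cat -addn1 leq_add ?size_step_word //.
    rewrite (leq_trans (size_comb_word _ _)) // -(ler_nat R).
    exact: le_trans pe eM.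
  - rewrite size_cat -add1n leq_add ?size_step_word //.
    rewrite (leq_trans (size_comb_word _ _)) // -(ler_nat R).
    exact: le_trans qe eM.
  - rewrite !eval_cat !eval_comb_word !eval_step_word // invMg -mulgA mulgA.
    by rewrite !mulgA mulgV mul1g.
have k0 := k_gt0.
set g' := (g * a)%g in qL qe *; set h' := (h * b)%g in qL qe *.
pose p := sigma g h; pose q := sigma g' h'; pose c t := comb_word (p t) (q t).
have p0 : p 0 = g by case: (sigmaP g h).
have q0 : q 0 = g' by case: (sigmaP g' h').
have pE : p L = h by apply: path_length_end (sigmaP g h) pL.
have qE : q L = h' by apply: path_length_end (sigmaP g' h') qL.
(* The joining paths either shrink by the factor [2 / k], or are bounded by [M / 2]; in the latter
   case the condition for the remaining rounds already holds, since [2 / k <= 1]. *)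
pose e' := Num.max (2 * e / k)%R (M%:R / 2)%R.
have lenc t : ((len (p t) (q t))%:R <= e')%R.
  apply: (le_trans (narrow g h t sa sb)); rewrite /e' le_max2 //.
  by rewrite ler_pM2r ?invr_gt0 //; move: pe qe; rewrite /g' /h'; lra.
(* The same time bound [L] serves in all rounds, because [2 < k] and [M <= L]. *)
have lencL t : len (p t) (q t) <= L.
  rewrite -(ler_nat R) (le_trans (narrow g h t sa sb)) // ge_max.
  rewrite -/g' -/h'; have M0 : (0 <= M%:R :> R)%R by [].
  move: pL qL ML; rewrite -!(ler_nat R) => pL qL ML.
  rewrite ler_pdivrMr //; apply/andP; split; last lra.
  have : (L%:R * 2 <= L%:R * k :> R)%R by rewrite ler_wpM2l // ltW.
  lra.
have e'M : (e' * (2 / k) ^+ j <= M%:R)%R.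
  have d1 : (0 <= 2 / k <= 1)%R.
    by apply/andP; split; rewrite ?ler_pdivrMr ?mul1r ?divr_ge0 // ltW.
  have d0 : (0 <= (2 / k) ^+ j)%R by rewrite exprn_ge0 //; case/andP: d1.
  have d2 : ((2 / k) ^+ j <= 1)%R by rewrite exprn_ile1 //; case/andP: d1.
  have M0 : (0 <= M%:R :> R)%R by [].
  rewrite /e'; case: (leP (2 * e / k)%R (M%:R / 2)%R) => _.
    by rewrite (le_trans (ler_wpM2l _ d2)) ?mulr1; lra.
  by rewrite (mulrC 2%R) -(mulrA e) -mulrA -exprS.
pose K := (L + 2) ^ j.
have quad t : exch P (c t ++ step_word ((q t)^-1 * q t.+1)%g)
    (step_word ((p t)^-1 * p t.+1)%g ++ c t.+1) K.
  have := @IHj (p t) (q t) ((p t)^-1 * p t.+1)%g ((q t)^-1 * q t.+1)%g e'.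
  rewrite !mulKVg; apply => //.
  - exact: path_step (sigmaP g h).
  - exact: path_step (sigmaP g' h').
(* The quadrilaterals at times below [t] are glued side by side. *)
have strip t : exch P (c 0 ++ path_word q 0 t) (path_word p 0 t ++ c t) (t * K).
  elim: t => [|t IHt]; first by rewrite cats0; apply: exch_refl.
  rewrite -[in path_word q _ _]addn1 -[in path_word p _ _]addn1 !path_wordD.
  rewrite !path_word1 !add0n mulSn addnC catA -catA.
  apply: (@exch_trans _ _ ((path_word p 0 t ++ c t) ++ step_word ((q t)^-1 * q t.+1)%g)).
    by rewrite catA; have := exch_ctx Pc [::] (step_word ((q t)^-1 * q t.+1)%g) IHt.
  by have := exch_ctx Pc (path_word p 0 t) [::] (quad t); rewrite !cats0 !catA.
(* The joining paths at times 0 and [L] replace the short sides [a] and [b] at one cell each, by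
   [len_step]. *)
have ends : exch P (step_word a) (c 0) 1 /\ exch P (step_word b) (c L) 1.
  rewrite /c p0 q0 pE qE; split; apply: exch_small;
    rewrite ?(leq_trans (size_step_word _)) ?(leq_trans (size_comb_word _ _)) //;
    rewrite ?(leq_trans (len_step _ _)) //;
    by rewrite eval_comb_word eval_step_word // mulKg.
have pw : comb_word g h = path_word p 0 L by rewrite (path_word_stable (sigmaP g h)).
have qw : comb_word g' h' = path_word q 0 L by rewrite (path_word_stable (sigmaP g' h')).
(* There are [L] pieces of cost [K] and two end cells; as [K] is positive, [L + 2] times [K]
   suffices. *)
rewrite pw qw; apply: (exch_mono Pc (m := 1 + L * K + 1)).
  rewrite expnS -/K mulnDl; have : 0 < K by rewrite expn_gt0 addn2.
  lia.
apply: (@exch_trans _ _ (c 0 ++ path_word q 0 L)); last first.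
  by have := exch_ctx Pc [::] (path_word q 0 L) (exch_sym ends.1).
apply: (@exch_trans _ _ (path_word p 0 L ++ c L)); last exact: exch_sym (strip L).
by have := exch_ctx Pc (path_word p 0 L) [::] ends.2; rewrite !cats0.
Qed.

(** By induction each prefix of [w] is exchanged for the combing word of its value; one more letter
    costs a cell and a quadrilateral. *)
Lemma comb_filling L j w : M <= L -> (L%:R * (2 / k) ^+ j <= M%:R :> R)%R ->
  (forall i, len 1%g (eval phi (take i w)) <= L) -> eval phi w = 1%g ->
  P w (size w * ((L + 2) ^ j).+1 + 3).
Proof.
move=> ML LM lenL w1; set K := (L + 2) ^ j.
have len11 : len 1%g 1%g <= M.
  by have := @len_step 1%g 1%g; rewrite mulg1; apply; rewrite /step eqxx.
have nilE : exch P [::] (comb_word 1%g 1%g) 1.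
  apply: exch_small => //; last by rewrite eval_comb_word invg1 mulg1.
  by rewrite (leq_trans (size_comb_word _ _)) // ltnW.
have cone i : i <= size w ->
    exch P (take i w) (comb_word 1%g (eval phi (take i w))) (1 + i * K.+1).
  elim: i => [|i IHi] iw; first by rewrite take0.
  have [l _] : exists l : letter A, True by case: (w) iw => // l; exists l.
  rewrite (take_nth l iw) -cats1 eval_cat /= mulg1; set x := nth l w i.
  set g := eval phi (take i w) in IHi *.
  have sx : step (eval_letter phi x) by rewrite /step phiX orbT.
  have := exch_ctx Pc [::] [:: x] (IHi (ltnW iw)) => /= H1.
  (* Different letters may have the same value in [G], so [step_word] may pick another one than [x];
     one cell corrects this. *)
  have H2 : exch P [:: x] (step_word (eval_letter phi x)) 1.
    apply: exch_small => //; rewrite ?(leq_trans (size_step_word _)) //.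
    by rewrite eval_step_word //= mulg1.
  have := exch_ctx Pc (comb_word 1%g g) [::] H2; rewrite !cats0 => {}H2.
  (* Both combing paths start at 1, so the side [a] of the quadrilateral is trivial. *)
  have s1 : step 1%g by rewrite /step eqxx.
  have := @exch_quad L j 1%g g 1%g (eval_letter phi x) L%:R%R s1 sx ML.
  rewrite step_word1 mulg1 /= !ler_nat -/g.
  have Lg : len 1%g g <= L by apply: lenL.
  have Lgx : len 1%g (g * eval_letter phi x)%g <= L.
    by have := lenL i.+1; rewrite (take_nth l iw) -cats1 eval_cat /= mulg1.
  move=> /(_ Lg Lgx Lg Lgx LM) H3.
  have := exch_trans H1 (exch_trans H2 H3); apply: (exch_mono Pc).
  by rewrite mulSn -/K; lia.
(* The final 3 counts a cell between the empty word and [sigma 1 1] at each end of the induction,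
   and one for the auxiliary pair of letters. *)
have H := cone _ (leqnn _); rewrite take_size w1 in H.
have {}H := exch_sym (exch_trans H (exch_sym nilE)).
apply: (fc_mono Pc _ (exch_nil_filling relsP Pc phi1 _ w1 H)); last by lia.
by rewrite -/K; lia.
Qed.

End Paths.

(** * Growth *)

Section Asymptotics.
Variable R : realType.
Local Open Scope ring_scope.

(** With [S] the sum of the absolute values of the coefficients, [S] times the power of [n] bounds
    [q], and [S] is itself at most a fixed power of [n] since [n >= 2]. *)
Lemma poly_le_expn (q : {poly R}) :
  exists d, forall n : nat, (1 < n)%N -> q.[n%:R] <= (n ^ d)%:R.
Proof.
pose S : R := \sum_(i < size q) `|q`_i|.
have S0 : 0 <= S by apply: sumr_ge0.
exists (Num.bound S + size q)%N => n n1; rewrite horner_coef.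
have n1R : 1 <= n%:R :> R by rewrite ler1n ltnW.
apply: (@le_trans _ _ (S * n%:R ^+ size q)).
  rewrite mulr_suml; apply: ler_sum => i _; apply: (le_trans (ler_norm _)).
  rewrite normrM normrX normr_nat ler_wpM2l //.
  by rewrite ler_weXn2l // ltnW.
rewrite expnD natrM [X in _ <= _ * X]natrX ler_wpM2r ?exprn_ge0 //.
apply: (le_trans (ltW (archi_boundP S0))); rewrite ler_nat ltnW //.
exact: ltn_expl.
Qed.

(** The integer part of the logarithm of [L] to base [x], plus one; used with [x = k / 2], the
    factor gained in each round. *)
Definition recursion_depth (x : R) (L : nat) := (Num.truncn (ln L%:R / ln x)).+1.

Lemma recursion_depthP x L : 1 < x -> (0 < L)%N ->
  L%:R <= x ^+ recursion_depth x L.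
Proof.
move=> x1 L0; have lx := ln_gt0 x1; have x0 : 0 < x by apply: lt_trans x1.
rewrite -ler_ln ?posrE ?ltr0n ?exprn_gt0 // lnXn // -[leRHS]mulr_natl -ler_pdivrMr //.
exact/ltW/truncnS_gt.
Qed.

Lemma recursion_depth_le x L d n : 1 < x -> (0 < L <= n ^ d)%N -> (1 < n)%N ->
  (recursion_depth x L)%:R <= d%:R * ln n%:R / ln x + 1.
Proof.
move=> x1 /andP[L0 Ln] n1; have lx := ln_gt0 x1.
have L1 : 0 <= ln L%:R :> R by rewrite ln_ge0 // ler1n.
rewrite /recursion_depth -natr1 lerD2r.
apply: (@le_trans _ _ (ln L%:R / ln x)); first by rewrite truncn_le divr_ge0 // ltW.
rewrite ler_pM2r ?invr_gt0 // mulr_natl -lnXn ?ltr0n ?(ltnW n1) //.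
by rewrite ler_ln ?posrE ?exprn_gt0 ?ltr0n ?(ltnW n1) // -natrX ler_nat.
Qed.

Lemma quasipolynomial x (L : nat -> nat) d : 1 < x -> (forall n, 0 < L n)%N ->
  (forall n, 1 < n -> L n + 2 <= n ^ d)%N ->
  exists C : R, 0 < C /\ forall n, (1 < n)%N ->
    (n * ((L n + 2) ^ recursion_depth x (L n)).+1 + 3)%:R
      <= n%:R `^ (C * ln n%:R).
Proof.
move=> x1 L0 Ld; have lx := ln_gt0 x1.
have l2 : 0 < ln 2%:R :> R by apply: ln_gt0; rewrite ltr1n.
(* The exponent will be at most [d j + 4] with [j <= d ln n / ln x + 1]. The constant part [d + 4]
   is absorbed into a multiple of [ln n] by [ln n >= ln 2]. *)
exists (d%:R * (d%:R / ln x) + (d%:R + 4) / ln 2%:R); split.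
  apply: ltr_wpDl; first by rewrite mulr_ge0 // divr_ge0 // ltW.
  by rewrite divr_gt0 // ltr_wpDl.
move=> n n1; set j := recursion_depth x (L n).
have n0 : (0 < n)%N by apply: ltnW.
apply: (@le_trans _ _ (n ^ (d * j + 4))%:R).
  rewrite ler_nat; apply: (@leq_trans (n * (n ^ (d * j)).+1 + 3)).
    by rewrite leq_add2r leq_mul2l ltnS expnM leq_exp2r ?Ld ?orbT.
  have X0 : (0 < n ^ (d * j))%N by rewrite expn_gt0 n0.
  rewrite expnD; set X := (n ^ (d * j))%N in X0 *.
  have n3 : (2 ^ 3 <= n ^ 3)%N by rewrite leq_exp2r.
  have nX : (0 < n * X)%N by rewrite muln_gt0 n0.
  have nn : (n <= n * X)%N by rewrite leq_pmulr.
  (* The factor 8 is at most [n ^ 3], which with the leading [n] gives the [+ 4] in the exponent. *)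
  apply: (@leq_trans (8 * (n * X))); first by rewrite mulnS; lia.
  by rewrite (mulnC X) expnSr -mulnA leq_mul2r n3 orbT.
rewrite natrX -powR_mulrn // ler_powR ?ler1n //.
have ln2n : ln 2%:R <= ln n%:R :> R by rewrite ler_ln ?posrE ?ltr0n ?ler_nat.
rewrite natrD natrM.
have jb : j%:R <= d%:R * ln n%:R / ln x + 1.
  by apply: recursion_depth_le; rewrite ?L0 //= (leq_trans _ (Ld n n1)) // leq_addr.
apply: (@le_trans _ _ (d%:R * (d%:R * ln n%:R / ln x + 1) + 4)).
  by rewrite lerD2r ler_wpM2l.
rewrite mulrDr mulr1 -addrA [leRHS]mulrDl lerD //.
  by rewrite -!mulrA (mulrC (ln x)^-1).
by rewrite mulrAC ler_pdivlMr // ler_wpM2l // addr_ge0.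
Qed.

End Asymptotics.

(** * The relators and the alphabet *)

Section ShortRelators.
Variables (A : finType) (G : groupType) (phi : A -> G) (N : nat).

Definition short_relators : seq (word A) :=
  [seq w <- flatten [seq [seq tval t | t <- enum {: n.-tuple (A * bool)}]
    | n <- iota 0 N.+1] | eval phi w == 1%g].

Lemma mem_short_relators w :
  (w \in short_relators) = (size w <= N) && (eval phi w == 1%g).
Proof.
rewrite mem_filter andbC; congr (_ && _); apply/flatten_mapP/idP => [[n]|wN].
  by rewrite mem_iota /= ltnS => nN /mapP[t _ ->]; rewrite size_tuple.
exists (size w); first by rewrite mem_iota.
by apply/mapP; exists (in_tuple w); rewrite ?mem_enum.
Qed.

End ShortRelators.

Lemma fills_area (A : finType) (rels : seq (word A)) w n :
  fills rels w n -> exists2 m, is_area rels w m & m <= n.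
Proof.
move=> [K [Kr Kw Kn]]; set S := [set m | exists K, [/\ diagram_over rels K,
  boundary_word K = w & num_cells K = m]]%classic.
have SK : S (num_cells K) by exists K.
exists (least S); first by apply: leastP; exists (num_cells K).
exact: leq_trans (least_le SK) Kn.
Qed.

Section Letters.
Variables (G : groupType) (X : {fset G}).
(** The identity is removed so that no letter is trivial in [G] and every letter is an edge of the
    Cayley graph. *)
Let A : finType := fset_sub_type (X `\ 1%g)%fset.
Let phi (a : A) : G := val a.

Lemma letter_val_neq1 a : phi a != 1%g.
Proof. by have := valP a; rewrite in_fsetD1 => /andP[]. Qed.

Lemma Xpm_letter (l : letter A) : Xpm X (eval_letter phi l).
Proof.
have := valP l.1; rewrite in_fsetD1 => /andP[_ lX].
by rewrite /Xpm /eval_letter; case: l.2; rewrite ?invgK lX ?orbT.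
Qed.

Lemma letter_of_Xpm x : Xpm X x -> x != 1%g ->
  exists l : letter A, eval_letter phi l = x.
Proof.
move=> /orP[] xX x1.
  have xA : x \in (X `\ 1%g)%fset by rewrite in_fsetD1 x1.
  by exists (FSetSub xA : A, false).
have xA : (x^-1)%g \in (X `\ 1%g)%fset by rewrite in_fsetD1 invg_eq1 x1.
by exists (FSetSub xA : A, true); rewrite /eval_letter /= invgK.
Qed.

Lemma generates_eval : generates X -> forall g, exists w, eval phi w = g.
Proof.
move=> gX g; pose S : {pred G} := fun g => `[< exists w, eval phi w = g >].
suff : g \in S by move/asboolP.
apply: gX => [x xX|].
  apply/asboolP; have [->|x1] := eqVneq x 1%g; first by exists [::].
  have [|l <-] := @letter_of_Xpm x _ x1; first by rewrite /Xpm xX.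
  by exists [:: l]; rewrite /= mulg1.
split=> [|x y /asboolP[u <-] /asboolP[v <-]]; apply/asboolP; first by exists [::].
by exists (u ++ word_inv v); rewrite eval_cat eval_inv.
Qed.

End Letters.

(** * The presentation and its isoperimetric function *)

Unset Implicit Arguments.
Set Strict Implicit.
Set Printing Implicit Defensive.
Local Open Scope ring_scope.

Theorem theorem2p1 (R : realType) (G : groupType) (X : {fset G})
    (hX : generates X)
    (hsigma : exists sigma : G -> G -> nat -> G, narrow_shape R X sigma) :
  exists (A : finType) (phi : A -> G) (rels : seq (word A)),
    presents phi rels /\
    exists (F : nat -> nat) (C : R),
      [/\ isoperimetric phi rels F, 0 < C
        & exists n0 : nat, forall n : nat, (n0 <= n)%N ->
            (F n)%:R <= n%:R `^ (C * ln n%:R)].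
Proof.
have [sigma [sigmaP [f [f_homo [q fq] len_f]] [M [k [M1 k2 len_diag narrow]]]]] := hsigma.
pose A : finType := fset_sub_type (X `\ 1%g)%fset; pose phi (a : A) : G := val a.
(* Two sides of length at most [M + 1], and the 2 extra letters of an exchange. *)
pose rels := short_relators phi (M.*2 + 4).
have kk : 1 < k / 2 by rewrite ltr_pdivlMr // mul1r.
(* A prefix of a word of length [n] lies within distance [n] of 1, so [f n] bounds its combing path;
   adding [M] ensures [M <= L n]. *)
pose L n := (f n + M)%N.
have L0 n : (0 < L n)%N by rewrite addn_gt0 (ltnW M1) orbT.
pose F n := (n * ((L n + 2) ^ recursion_depth (k / 2) (L n)).+1 + 3)%N.
have phi1 : forall a, phi a != 1%g by apply: letter_val_neq1.
have phiX : forall l : letter A, Xpm X (eval_letter phi l) by apply: Xpm_letter.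
have Xphi : forall x, Xpm X x -> x != 1%g -> exists l : letter A, eval_letter phi l = x.
  by apply: letter_of_Xpm.
(* Used twice: with [P] the normal closure for the presentation, and with [P] the diagrams for the
   area. *)
have fill P : filling_closed rels P ->
    forall w : word A, eval phi w = 1%g -> P w (F (size w)).
  move=> Pc w; apply: (comb_filling phi1 phiX Xphi sigmaP M1 k2 len_diag narrow
    (mem_short_relators phi _) Pc) => //; first exact: leq_addl.
    have k0 : 0 < k by apply: lt_trans k2.
    rewrite -[2 / k]invf_div exprVn ler_pdivrMr ?exprn_gt0 ?divr_gt0 //.
    apply: (le_trans (recursion_depthP kk (L0 _))).
    by rewrite ler_peMl ?exprn_ge0 ?divr_ge0 ?ler1n ?(ltnW M1) // ltW.
  move=> i; apply: leq_trans (leq_addr _ _); apply: leq_trans (len_f _) _.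
  have f_mono : {homo f : m n / (m <= n)%N} by apply: ltnW_homo.
  apply: f_mono; apply: leq_trans (word_metric_eval phi1 phiX _) _.
  by rewrite size_take; case: ltnP => // /ltnW.
exists A, phi, rels; split; first split.
- exact: generates_eval.
- move=> w; split=> [w1|].
    exact: (fill _ (normal_closure_closed rels)).
  by apply: eval_normal_closure => r; rewrite mem_short_relators => /andP[_ /eqP].
(* This polynomial takes the value [L n + 2] at [n]. *)
have [d Ld] := poly_le_expn (q + (M + 2)%:R%:P).
have [n|C [C0 FC]] := quasipolynomial kk L0 (d := d).
  move=> n1; have := Ld n n1; rewrite hornerD hornerC -fq -natrD ler_nat.
  by rewrite addnA.
exists F, C; split => //; last by exists 2%N.
by move=> w /(fill _ (fills_closed rels))/fills_area.
Qed.
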